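(* Let $p\in(0,1)$ be a constant and $G_n\sim G(n,p)$. Let $F$ be a graph such that $\mathrm{wsat}(K_n,F)=(c_F+o(1))n$ as $n\to\infty$ for some constant $c_F\geq 0$. Then with probability tending to $1$ as $n\to\infty$, $$\mathrm{rk}\text{-}\mathrm{sat}(G_n,F)\leq\lfloor c_F\rfloor n+(\log n)^{O(1)}.$$
   Context: $G(n,p)$ is the binomial random graph on $[n]$. $\mathrm{wsat}(G,F)$ is the minimum number of edges of a spanning subgraph $H\subseteq G$ from which $G$ can be obtained by adding missing edges one at a time, each added edge creating a new copy of $F$ containing it. A matroid $M$ on $E(G)$ is weakly $F$-saturated if every copy $\tilde F$ of $F$ in $G$ is a cycle of $M$, i.e. $\mathrm{rk}_M(E(\tilde F)\setminus\{e\})=\mathrm{rk}_M(E(\tilde F))$ for all $e\in E(\tilde F)$; $\mathrm{rk}\text{-}\mathrm{sat}(G,F)$ is the maximum rank of such a matroid. The term $(\log n)^{O(1)}$ means $(\log n)^{D}$ for some constant $D$ not depending on $n$. *)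

(* Defs.v *)
From HB Require Import structures.
From mathcomp Require Import all_boot all_order all_algebra.
From mathcomp Require Import boolp classical_sets reals topology normedtype sequences exp.
Set Implicit Arguments. Unset Strict Implicit. Unset Printing Implicit Defensive.
Import Order.TTheory GRing.Theory Num.Theory.

(* A (simple) graph on vertex set 'I_n is given by its edge set, a set of
   2-element subsets of 'I_n. *)
Definition is_graph n (E : {set {set 'I_n}}) : Prop := forall e, e \in E -> #|e| = 2.

Definition Kn n : {set {set 'I_n}} := [set e : {set 'I_n} | #|e| == 2].

Definition copy_edges k n (EF : {set {set 'I_k}}) (phi : 'I_k -> 'I_n)
  : {set {set 'I_n}} := [set phi @: e | e : {set 'I_k} in EF].

Definition is_copy k n (EF : {set {set 'I_k}}) (EG C : {set {set 'I_n}}) : Prop :=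
  exists phi : 'I_k -> 'I_n, injective phi /\ C = copy_edges EF phi /\ C \subset EG.

Definition wsat_witness k n (EF : {set {set 'I_k}}) (EG H : {set {set 'I_n}}) : Prop :=
  H \subset EG /\
  exists s : seq {set 'I_n},
    [/\ uniq s, (forall x, x \in s -> x \notin H), EG = H :|: [set x in s] &
        forall i, i < size s ->
          exists C, is_copy EF (H :|: [set x in take i.+1 s]) C /\ nth finset.set0 s i \in C].

(* wsat(G,F): minimum number of edges of such an H (H = G always works). *)
Definition wsat k n (EF : {set {set 'I_k}}) (EG : {set {set 'I_n}}) : nat :=
  \big[minn/#|EG|]_(m < #|EG|.+1 | `[< exists H, wsat_witness EF EG H /\ #|H| = m >]) m.

Definition matroid_rank n (EG : {set {set 'I_n}}) (r : {set {set 'I_n}} -> nat) : Prop :=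
  forall A B : {set {set 'I_n}}, A \subset EG -> B \subset EG ->
    [/\ r A <= #|A|, (A \subset B -> r A <= r B) &
        r (A :|: B) + r (A :&: B) <= r A + r B].

(* Every copy of F in G is a cycle of the matroid. *)
Definition weakly_F_saturated k n (EF : {set {set 'I_k}}) (EG : {set {set 'I_n}})
  (r : {set {set 'I_n}} -> nat) : Prop :=
  forall C, is_copy EF EG C -> forall e, e \in C -> r (C :\ e) = r C.

(* rk-sat(G,F): maximum rank r(E(G)) of a weakly F-saturated matroid on E(G)
   (ranks are at most #|E(G)|, and the zero matroid shows the max is attained). *)
Definition rksat k n (EF : {set {set 'I_k}}) (EG : {set {set 'I_n}}) : nat :=
  \max_(m < #|EG|.+1 | `[< exists r, [/\ matroid_rank EG r,
                                       weakly_F_saturated EF EG r & r EG = m] >]) m.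

Definition Gnp_prob (R : realType) n (p : R) (A : pred {set {set 'I_n}}) : R :=
  (\sum_(H : {set {set 'I_n}} | (H \subset Kn n) && A H)
     p ^+ #|H| * (1 - p) ^+ (#|Kn n| - #|H|))%R.

(* Main.v *)
Require Import Defs.
From HB Require Import structures.
From mathcomp Require Import all_boot all_order all_algebra.
From mathcomp Require Import boolp classical_sets reals topology normedtype sequences exp.
From mathcomp Require Import fintype finset zify lra.
Set Implicit Arguments. Unset Strict Implicit. Unset Printing Implicit Defensive.
Import Order.TTheory GRing.Theory Num.Theory.
Import numFieldNormedType.Exports.

(** Let f = floor c and fix N with wsat(K_N, F) < (f + 1) (N - k).  With high
    probability G has a set A of log^2 n vertices such that every bounded set
    of vertices has a common neighbour in A, and no independent set of size
    log^2 n; by Ramsey, every set of polylogarithmic size then contains an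
    N-clique.  Let r be the rank of a weakly F-saturated matroid on G and, for
    B containing A, consider the increments r(G[B + v]) - r(G[B]).  Since a copy
    of F fits in any large clique with a prescribed edge, the increment of v
    over B is at most its increment over any clique Q of B joined to v.
    Enlarge A greedily by vertices of increment at least f + 1: after
    polylogarithmically many steps the added vertices would contain an N-clique
    of rank at least (f + 1) (N - k), whereas its rank is at most wsat(K_N, F).
    So the process stops early at some B, and all other vertices contribute at
    most f each, edges outside B being spanned through common cliques in A. *)

(** * Cliques in a graph: Ramsey bound and common neighbourhoods *)

Definition induced n (EG : {set {set 'I_n}}) (S : {set 'I_n}) : {set {set 'I_n}} :=
  [set e in EG | e \subset S].

(** The guard [x != y] makes [joined EG S S] say that [S] is a clique, and lets [X] and [Y]
    overlap. *)
Definition joined n (EG : {set {set 'I_n}}) (X Y : {set 'I_n}) : Prop :=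
  forall x y, x \in X -> y \in Y -> x != y -> [set x; y] \in EG.

Section Graph.
Variables (n : nat) (EG : {set {set 'I_n}}).
Implicit Types (S T X Y Q M : {set 'I_n}).

Lemma induced_sub S : induced EG S \subset EG.
Proof. by apply/subsetP => e; rewrite inE => /andP[]. Qed.

Lemma inducedS S T : S \subset T -> induced EG S \subset induced EG T.
Proof.
move=> ST; apply/subsetP => e; rewrite !inE => /andP[-> /= eS].
exact: subset_trans eS ST.
Qed.

Lemma joinedS X Y X' Y' :
  X' \subset X -> Y' \subset Y -> joined EG X Y -> joined EG X' Y'.
Proof.
by move=> /subsetP XX /subsetP YY XY x y /XX xX /YY yY; apply: XY.
Qed.

Lemma joinedC X Y : joined EG X Y -> joined EG Y X.
Proof. by move=> XY x y xY yX xy; rewrite setUC; apply: XY => //; rewrite eq_sym. Qed.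

Lemma joinedU X Y Z : joined EG X Z -> joined EG Y Z -> joined EG (X :|: Y) Z.
Proof. by move=> XZ YZ x z; rewrite inE => /orP[]; [apply: XZ | apply: YZ]. Qed.

Lemma joined1 x : joined EG [set x] [set x].
Proof. by move=> y z; rewrite !inE => /eqP-> /eqP->; rewrite eqxx. Qed.

Lemma joinedUU X Y :
  joined EG X X -> joined EG Y Y -> joined EG X Y -> joined EG (X :|: Y) (X :|: Y).
Proof.
move=> XX YY XY.
have YX := joinedC XY.
apply: joinedU; apply: joinedC; exact: joinedU.
Qed.

Lemma card_induced S : EG \subset Kn n -> #|induced EG S| <= #|S| ^ 2.
Proof.
move=> sG; apply: (@leq_trans #|[set e : {set 'I_n} | (e \subset S) && (#|e| == 2)]|).
  apply/subset_leq_card/subsetP => e; rewrite !inE => /andP[/(subsetP sG)].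
  by rewrite inE => -> ->.
rewrite cards_draws bin2 -divn2 -mulnn; apply: leq_trans (leq_div _ _) _.
by rewrite leq_mul2l leq_pred orbT.
Qed.

(* Off-diagonal Ramsey bound R(N, s) <= s ^ N: a maximal independent set
   dominates T, so one of its fewer than s vertices has s ^ N neighbours. *)
Lemma clique_in_large_set s N T :
  (forall I : {set 'I_n}, #|I| = s -> exists x y, [/\ x \in I, y \in I, x != y & [set x; y] \in EG]) ->
  s ^ N <= #|T| -> exists S, [/\ S \subset T, #|S| = N & joined EG S S].
Proof.
move=> indep; elim: N T => [|N IH] T.
  move=> _; exists set0; split; rewrite ?sub0set ?cards0 // => x y.
  by rewrite inE.
move=> cT.
pose ind (I : {set 'I_n}) :=
  (I \subset T) && [forall x in I, forall y in I, (x != y) ==> ([set x; y] \notin EG)].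
have ind0 : ind set0.
  by rewrite /ind sub0set; apply/forall_inP => x; rewrite inE.
have [I /maxsetP[/andP[sI /forall_inP iI] maxI] _] := maxset_exists ind0.
have cI : #|I| < s.
  rewrite ltnNge; apply/negP => /card_geqP[sq [usq szq ssq]].
  have [|x [y [xJ yJ xy xyG]]] := indep [set x in sq].
    by rewrite cardsE (card_uniqP usq).
  rewrite !inE in xJ yJ.
  have /forall_inP/(_ y (ssq _ yJ)) := iI x (ssq _ xJ).
  by rewrite xy xyG.
pose nb i := [set y in T | (i != y) && ([set i; y] \in EG)].
have domT : T \subset \bigcup_(i in I) (i |: nb i).
  apply/subsetP => y yT; apply/bigcupP.
  have [yI|yI] := boolP (y \in I); first by exists y; rewrite // !inE eqxx.
  apply/exists_inP; apply: contraT => /exists_inPn noI.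
  suff /maxI/(_ (subsetUr _ _)) E : ind (y |: I).
    by move: yI; rewrite -E !inE eqxx.
  have ny i : i \in I -> (i != y) && ([set i; y] \notin EG).
    move=> iI'; have := noI _ iI'; rewrite !inE yT /= eq_sym.
    have -> : i != y by apply: contraNneq yI => <-.
    by rewrite orbC /= negb_or => /andP[].
  rewrite /ind subUset sub1set yT sI /=.
  apply/forall_inP => a; rewrite !inE => /orP[/eqP->|aI];
    apply/forall_inP => b; rewrite !inE => /orP[/eqP->|bI].
  - by rewrite eqxx.
  - by rewrite setUC; have /andP[_ ->] := ny _ bI; rewrite implybT.
  - by have /andP[_ ->] := ny _ aI; rewrite implybT.
  - by have /forall_inP/(_ _ bI) := iI a aI.
(* Otherwise each [i |: nb i] has at most [s ^ N] elements, the vertex [i] included, and fewer than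
   [s] such sets cannot cover [T]. *)
have [i iI' ci] : exists2 i, i \in I & s ^ N <= #|nb i|.
  apply/exists_inP; apply: contraT => /exists_inPn small.
  have : #|T| <= \sum_(i in I) s ^ N.
    apply: (leq_trans (subset_leq_card domT)).
    apply: (@leq_trans (\sum_(i in I) #|i |: nb i|)).
      elim/big_rec2: _ => [|i a b _ h]; first by rewrite cards0.
      by rewrite (leq_trans (leq_card_setU _ _).1) // leq_add2l.
    apply: leq_sum => i /small; rewrite -ltnNge => h.
    by apply: leq_trans h; rewrite cardsU1; case: (_ \notin _).
  rewrite sum_nat_const => h.
  have : s ^ N.+1 <= #|I| * s ^ N by exact: leq_trans cT h.
  rewrite expnS leq_pmul2r ?expn_gt0; first by rewrite leqNgt cI.
  by rewrite (leq_ltn_trans _ cI).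
have [S [sS cS jS]] := IH _ ci.
exists (i |: S); split.
- rewrite subUset sub1set (subsetP sI) //=.
  apply: (subset_trans sS); apply/subsetP => y; by rewrite inE => /andP[].
- rewrite cardsU1 cS; case: (boolP (i \in S)) => // /(subsetP sS).
  by rewrite !inE eqxx andbF.
- apply: joinedUU => // [|x y]; first exact: joined1.
  rewrite inE => /eqP-> /(subsetP sS).
  by rewrite inE => /and3P[].
Qed.

(** The vertices of [Q] are picked one at a time, each a common neighbour of [M] and of the earlier
    picks. The last pick must dominate [#|M| + q - 1] vertices, whence the bound [m.+1]. *)
Lemma common_clique (A : {set 'I_n}) m q M :
  (forall M, #|M| <= m -> exists2 a, a \in A :\: M & joined EG [set a] M) ->
  #|M| + q <= m.+1 ->
  exists Q, [/\ Q \subset A, #|Q| = q, [disjoint Q & M], joined EG Q Q & joined EG Q M].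
Proof.
move=> ext; elim: q M => [|q IH] M cM.
  exists set0; split; rewrite ?sub0set ?cards0 ?disjoints_subset ?sub0set //;
  by move=> x y; rewrite inE.
have [|a] := ext M; first by lia.
rewrite inE => /andP[aM aA] aj.
have [|Q [sQ cQ dQ jQ jQM]] := IH (a |: M).
  by move: cM; rewrite cardsU1 aM; lia.
have aQ : a \notin Q.
  by apply/negP => aQ; move/pred0P/(_ a): dQ; rewrite /= !inE aQ eqxx.
exists (a |: Q); split.
- by rewrite subUset sub1set aA.
- by rewrite cardsU1 aQ cQ.
- rewrite disjoints_subset subUset sub1set inE aM /= -disjoints_subset.
  by apply: disjointWr dQ; exact: subsetUr.
- apply: joinedUU => //; first exact: joined1.
  apply: joinedC; apply: joinedS jQM => //; exact: subsetUl.
- apply: joinedU => //; apply: joinedS jQM => //; exact: subsetUr.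
Qed.

End Graph.

(** * Matroid closure and weakly saturated matroids *)

Lemma wsat_attained k n (EF : {set {set 'I_k}}) (EG : {set {set 'I_n}}) :
  exists H, wsat_witness EF EG H /\ #|H| = wsat EF EG.
Proof.
rewrite /wsat; elim/big_ind: _ => [|x y hx hy|i /asboolP //].
  exists EG; split=> //; split=> //; exists [::]; split=> //.
  by apply/setP => e; rewrite !inE orbF.
by rewrite /minn; case: ifP.
Qed.

(** The flat spanned by [X]. It is cut down to [EG] because [r] is constrained only on subsets of
    [EG]; by monotonicity [<=] here means equality. *)
Definition closure_of n (EG : {set {set 'I_n}}) (r : {set {set 'I_n}} -> nat)
  (X : {set {set 'I_n}}) : {set {set 'I_n}} := [set e in EG | r (e |: X) <= r X].

Section Matroid.
Variables (n : nat) (EG : {set {set 'I_n}}) (r : {set {set 'I_n}} -> nat).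
Hypothesis mr : matroid_rank EG r.
Local Notation cl := (closure_of EG r).
Implicit Types (X Y C : {set {set 'I_n}}).

Lemma rank_le_card X : X \subset EG -> r X <= #|X|.
Proof. by move=> sX; have [] := mr sX sX. Qed.

Lemma rankS X Y : X \subset Y -> Y \subset EG -> r X <= r Y.
Proof.
by move=> sXY sY; have [_ h _] := mr (subset_trans sXY sY) sY; apply: h.
Qed.

Lemma rank_submod X Y :
  X \subset EG -> Y \subset EG -> r (X :|: Y) + r (X :&: Y) <= r X + r Y.
Proof. by move=> sX sY; have [] := mr sX sY. Qed.

Lemma closure_sub X : cl X \subset EG.
Proof. by apply/subsetP => e; rewrite inE => /andP[]. Qed.

Lemma sub_closure X : X \subset EG -> X \subset cl X.
Proof.
move=> sX; apply/subsetP => e eX; rewrite inE (subsetP sX) //=.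
by rewrite (setUidPr _) // sub1set.
Qed.

(** Submodularity for [e |: X] and [Y]: if [e] lies outside [Y], they meet exactly in [X]. *)
Lemma closureS X Y : X \subset Y -> Y \subset EG -> cl X \subset cl Y.
Proof.
move=> sXY sY; apply/subsetP => e; rewrite !inE => /andP[eG h]; rewrite eG /=.
have sX := subset_trans sXY sY.
have [eY|eY] := boolP (e \in Y); first by rewrite (setUidPr _) // sub1set.
have seX : e |: X \subset EG by rewrite subUset sub1set eG.
have := rank_submod seX sY.
rewrite -setUA (setUidPr sXY) setIUl (setIidPl sXY).
rewrite [_ :&: Y](_ : _ = set0) ?set0U; first lia.
by apply/setP => z; rewrite !inE; case: eqP => // ->; rewrite (negPf eY).
Qed.

(** Remove the elements of [Y] one by one: each lies in the closure of [X] and the remaining ones,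
    so its removal leaves the rank unchanged. *)
Lemma rankU_closure X Y : X \subset EG -> Y \subset cl X -> r (X :|: Y) <= r X.
Proof.
move=> sX; elim: {Y}_.+1 {-2}Y (ltnSn #|Y|) => // m IH Y cY sY.
have [->|[e eY]] := set_0Vmem Y; first by rewrite setU0.
have sYe : Y :\ e \subset cl X := subset_trans (subsetDl _ _) sY.
have := IH (Y :\ e); rewrite (cardsD1 e) eY in cY.
move=> /(_ _ sYe) h; apply: leq_trans (h _); last by lia.
have sXY : X :|: (Y :\ e) \subset EG.
  by rewrite subUset sX (subset_trans sYe) ?closure_sub.
have /subsetP/(_ e) := closureS (subsetUl X (Y :\ e)) sXY.
rewrite (subsetP sY) // => /(_ isT); rewrite inE => /andP[_].
by rewrite setUCA setD1K.
Qed.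

Lemma rank_closure_le X Y : X \subset EG -> Y \subset cl X -> r Y <= r X.
Proof.
move=> sX sY; apply: leq_trans (rankU_closure sX sY); apply: rankS.
  exact: subsetUr.
by rewrite subUset sX (subset_trans sY) ?closure_sub.
Qed.

Lemma closureK X : X \subset EG -> cl (cl X) \subset cl X.
Proof.
move=> sX; apply/subsetP => e; rewrite !inE => /andP[eG h]; rewrite eG /=.
apply: leq_trans (rank_closure_le sX (subxx (cl X))).
apply: leq_trans h; apply: rankS; last by rewrite subUset sub1set eG closure_sub.
by apply: setUS; apply: sub_closure.
Qed.

Section Saturated.
Variables (k : nat) (EF : {set {set 'I_k}}).
Hypothesis sat : weakly_F_saturated EF EG r.

(** A copy of F is a cycle, so [e] is in the closure of [C :\ e]; idempotence of closure does the
    rest. *)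
Lemma closure_copy X C e :
  X \subset EG -> is_copy EF EG C -> e \in C -> C :\ e \subset cl X -> e \in cl X.
Proof.
move=> sX cC eC sC.
have sCG : C \subset EG by case: cC => phi [_ []].
have eG := subsetP sCG _ eC.
apply: (subsetP (closureK sX)); apply: (subsetP (closureS sC (closure_sub X))).
by rewrite inE eG setD1K // (sat cC eC) /=.
Qed.

Lemma copy_edges_sub (phi : 'I_k -> 'I_n) (S : {set 'I_n}) :
  is_graph EF -> injective phi -> (forall x, phi x \in S) -> joined EG S S ->
  copy_edges EF phi \subset induced EG S.
Proof.
move=> gF iphi pS jS; apply/subsetP => _ /imsetP[e eF ->].
have /eqP/cards2P[x [y [xy ->]]] := gF _ eF.
rewrite imsetU !imset_set1 inE subUset !sub1set !pS !andbT.
by apply: jS => //; apply: contraNneq xy => /iphi->.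
Qed.

(* A copy of F in the clique Q + u + w can be placed with an edge on uw. *)
Lemma closure_clique_edge X (Q : {set 'I_n}) u w :
  is_graph EF -> EF != set0 -> X \subset EG -> k <= #|Q| -> u != w ->
  u \notin Q -> w \notin Q ->
  joined EG (Q :|: [set u; w]) (Q :|: [set u; w]) ->
  induced EG (Q :|: [set u; w]) :\ [set u; w] \subset cl X ->
  [set u; w] \in cl X.
Proof.
move=> gF /set0Pn[e0 e0F] sX kQ uw uQ wQ jQ sQ.
have /eqP/cards2P[x [y [xy e0E]]] := gF _ e0F.
(* The edge [xy] of F will go to [uw], and the other vertices of F go into [Q], which has room for
   all [k] of them. *)
pose g (z : 'I_k) : 'I_n := enum_val (widen_ord kQ z).
have gQ z : g z \in Q by apply: enum_valP.
have ginj : injective g.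
  by move=> a b /enum_val_inj/(congr1 val) /= ab; apply: val_inj.
pose phi z := if z == x then u else if z == y then w else g z.
have ug z : (u == g z) = false by apply: contraNF uQ => /eqP->.
have wg z : (w == g z) = false by apply: contraNF wQ => /eqP->.
have iphi : injective phi.
  move=> a b; rewrite /phi.
  case: (eqVneq a x) => [->|ax]; case: (eqVneq b x) => [->|bx] //.
  - case: (eqVneq b y) => [_ /eqP|_ /eqP]; by rewrite ?(negPf uw) ?ug.
  - case: (eqVneq a y) => [_ /eqP|_ /eqP]; by rewrite eq_sym ?(negPf uw) ?ug.
  case: (eqVneq a y) => [->|ay]; case: (eqVneq b y) => [->|by_] //.
  - by move=> /eqP; rewrite wg.
  - by move=> /eqP; rewrite eq_sym wg.
  exact: ginj.
have sC := @copy_edges_sub phi _ gF iphi _ jQ.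
have {}sC : copy_edges EF phi \subset induced EG (Q :|: [set u; w]).
  apply: sC => z; rewrite /phi !inE; case: eqP => _; first by rewrite eqxx orbT.
  by case: eqP => _; rewrite ?eqxx ?gQ ?orbT.
apply: (@closure_copy X (copy_edges EF phi)) => //.
- exists phi; split=> //; split=> //; exact: subset_trans sC (induced_sub _ _).
- apply/imsetP; exists e0 => //; rewrite e0E imsetU !imset_set1 /phi eqxx.
  by rewrite eq_sym (negPf xy) eqxx.
- by apply: subset_trans sQ; apply: setSD.
Qed.


(** Transport an optimal saturation process of the complete graph to [S]. Each added edge completes
    a copy of F, hence is spanned by the earlier edges; so the image of the starting graph spans the
    whole clique. *)
Lemma rank_clique_le_wsat (S : {set 'I_n}) :
  EG \subset Kn n -> joined EG S S -> r (induced EG S) <= wsat EF (Kn #|S|).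
Proof.
move=> sG jS; set N := #|S|.
have [H [[sH [s [_ _ HE sC]]] <-]] := wsat_attained EF (Kn N).
pose psi (i : 'I_N) : 'I_n := enum_val i.
have psiS i : psi i \in S by apply: enum_valP.
have ipsi : injective psi by apply: enum_val_inj.
pose f (e : {set 'I_N}) := psi @: e.
have fG e : e \in Kn N -> f e \in EG.
  rewrite inE => /cards2P[x [y [xy ->]]]; rewrite /f imsetU !imset_set1.
  by apply: jS => //; apply: contraNneq xy => /ipsi->.
pose X := f @: H.
have sX : X \subset EG.
  by apply/subsetP => _ /imsetP[e eH ->]; apply: fG; apply: (subsetP sH).
(* Invariant of the process: after [i] additions, every edge present is mapped into the closure of
   the starting graph's image. *)
have fcl i e : i <= size s -> e \in H :|: [set x in take i s] -> f e \in cl X.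
  elim: i e => [|i IH] e.
    rewrite take0 => _ /setUP[eH|]; last by rewrite inE.
    exact: (subsetP (sub_closure sX) _ (imset_f f eH)).
  move=> si; have {}IH e' := IH e' (ltnW si).
  move=> /setUP[eH|]; first by apply: IH; rewrite inE eH.
  rewrite (take_nth set0) // in_set mem_rcons in_cons => /orP[/eqP->|es];
    last by apply: IH; rewrite !inE es orbT.
  set e1 := nth _ _ _.
  have [C [[phi [iphi [CE sCH]]] e1C]] := sC i si.
  have sCK : C \subset Kn N.
    apply: (subset_trans sCH); rewrite HE; apply: setUS; apply/subsetP => x.
    by rewrite !inE => /mem_take.
  have C'E : copy_edges EF (psi \o phi) = f @: C.
    rewrite CE /copy_edges -imset_comp; apply: eq_imset => e' /=.
    by rewrite /f imset_comp.
  apply: (@closure_copy X (f @: C)) => //.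
  - exists (psi \o phi); split; first exact: inj_comp.
    split=> //; apply/subsetP => _ /imsetP[c cC ->]; apply: fG.
    exact: (subsetP sCK).
  - exact: imset_f.
  - apply/subsetP => e'; rewrite inE in_set1 => /andP[ne /imsetP[c cC e'E]].
    rewrite e'E; apply: IH.
    have := subsetP sCH _ cC; rewrite (take_nth set0) // !inE mem_rcons inE.
    case: eqP => [cE|_] //=; by rewrite e'E cE eqxx in ne.
apply: (@leq_trans (r X)); last first.
  by apply: leq_trans (rank_le_card sX) _; apply: leq_imset_card.
apply: rank_closure_le => //; apply/subsetP => e; rewrite inE => /andP[eG eS].
have := subsetP sG _ eG; rewrite inE => /cards2P[x [y [xy eE]]].
have xS : x \in S by apply: (subsetP eS); rewrite eE !inE eqxx.
have yS : y \in S by apply: (subsetP eS); rewrite eE !inE eqxx orbT.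
pose e' : {set 'I_N} := [set enum_rank_in xS x; enum_rank_in xS y].
have fe' : f e' = e by rewrite /f imsetU !imset_set1 /psi !enum_rankK_in.
rewrite -fe'; apply: (fcl (size s)) => //; rewrite take_size -HE inE.
rewrite cards2.
have -> // : enum_rank_in xS x != enum_rank_in xS y.
apply: contraNneq xy => h.
by rewrite -(enum_rankK_in xS xS) h enum_rankK_in.
Qed.

End Saturated.
End Matroid.

(** * Deterministic rank bound from greedy vertex additions *)

Section RankBound.
Variables (n k N m : nat) (EF : {set {set 'I_k}}) (EG : {set {set 'I_n}}).
Variables (r : {set {set 'I_n}} -> nat) (A : {set 'I_n}).
Hypotheses (gF : is_graph EF) (EF0 : EF != set0) (sG : EG \subset Kn n).
Hypotheses (mr : matroid_rank EG r) (sat : weakly_F_saturated EF EG r).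
Hypothesis ext : forall M : {set 'I_n}, #|M| <= m ->
  exists2 a, a \in A :\: M & joined EG [set a] M.
Hypothesis mE : N + k + 1 <= m.
Local Notation cl := (closure_of EG r).
Local Notation E := (induced EG).
Implicit Types (B Q S U : {set 'I_n}).

Lemma edge_at e v : e \in EG -> v \in e -> exists w, v != w /\ e = [set v; w].
Proof.
move=> /(subsetP sG); rewrite inE => /cards2P[x [y [xy ->]]].
rewrite !inE => /orP[] /eqP->; [by exists y | exists x].
by rewrite setUC eq_sym.
Qed.

(* From the edges joining v to Q one reaches those joining v to a clique Q'
   attached to all of Q + v + a, and from these the edge va. *)
Lemma closure_star B Q v :
  A \subset B -> v \notin B -> Q \subset B -> k <= #|Q| -> #|Q| <= N ->
  joined EG Q Q -> joined EG [set v] Q ->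
  E (v |: B) \subset cl (E B :|: E (v |: Q)).
Proof.
move=> sAB vB sQB kQ QN jQ jvQ; set X := E B :|: E (v |: Q).
have sX : X \subset EG by rewrite subUset !induced_sub.
have XclX : X \subset cl X by apply: sub_closure.
have sEB S : S \subset B -> E S \subset X.
  by move=> /(inducedS EG) h; apply: subset_trans h _; apply: subsetUl.
have vQ : v \notin Q by apply: contraNN vB => /(subsetP sQB).
have edgeB a : a \in B -> [set v; a] \in EG -> [set v; a] \in cl X.
  move=> aB vaG.
  have va : v != a by apply: contraNneq vB => ->.
  (* This exhausts the budget [m]: at most [N + 2] vertices to dominate, plus [k] vertices of
     [Q']. *)
  have [|Q' [sQ' cQ' dQ' jQ' jQ'M]] :=
    @common_clique n EG A m k (Q :|: [set v; a]) ext.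
    have := (leq_card_setU Q [set v; a]).1; rewrite cards2 va.
    by move: QN mE; clear; lia.
  have dQ'x x : x \in Q :|: [set v; a] -> x \notin Q'.
    by move=> xM; apply/negP => xQ'; move/pred0P/(_ x): dQ'; rewrite /= xQ' xM.
  have vQ' : v \notin Q' by apply: dQ'x; rewrite !inE eqxx orbT.
  have aQ' : a \notin Q' by apply: dQ'x; rewrite !inE eqxx !orbT.
  have sQ'B := subset_trans sQ' sAB.
  have jQ'v : joined EG Q' [set v; a] by apply: joinedS jQ'M => //; apply: subsetUr.
  have vQ'cl w : w \in Q' -> [set v; w] \in cl X.
    move=> wQ'; have wB := subsetP sQ'B _ wQ'.
    have vw : v != w by apply: contraNneq vB => ->.
    have wQ : w \notin Q.
      by apply/negP => wQ; move: (dQ'x w); rewrite inE wQ wQ' => /(_ isT).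
    have jwQ : joined EG [set w] Q.
      by apply: joinedS jQ'M; rewrite ?sub1set // subsetUl.
    have jvw : joined EG [set v] [set w].
      by apply: joinedC; apply: joinedS jQ'v; rewrite sub1set // !inE eqxx.
    apply: (@closure_clique_edge _ _ _ mr _ _ sat X Q) => //.
      apply: joinedUU => //.
        by apply: joinedUU => //; apply: joined1.
      by apply: joinedC; apply: joinedU.
    (* In the clique on [Q], [v] and [w], every edge other than [vw] is in [X]: those at [v] lie in
       [E (v |: Q)], the others in [E B]. *)
    apply: subset_trans XclX; apply/subsetP => e.
    rewrite inE in_set1 inE => /and3P[ne eG eS].
    have [ve|ve] := boolP (v \in e).
      apply/setUP; right; rewrite inE eG; apply/subsetP => z ze.
      have := subsetP eS _ ze; rewrite !inE orbCA => /orP[->|/orP[->|/eqP zw]] //.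
        by rewrite orbT.
      have [w' [_ eE]] := edge_at eG ve; rewrite zw eE !inE eq_sym (negPf vw) /= in ze.
      by rewrite eE (eqP ze) eqxx in ne.
    apply/setUP; left; rewrite inE eG; apply/subsetP => z ze.
    have := subsetP eS _ ze; rewrite !inE => /orP[/(subsetP sQB)//|/orP[/eqP zv|/eqP->//]].
    by rewrite -zv ze in ve.
  apply: (@closure_clique_edge _ _ _ mr _ _ sat X Q') => //; first by rewrite cQ'.
    apply: joinedUU => //; apply: joinedUU; try exact: joined1.
    by move=> x y; rewrite !inE => /eqP-> /eqP->.
  apply/subsetP => e; rewrite inE in_set1 inE => /and3P[ne eG eS].
  have [ve|ve] := boolP (v \in e); last first.
    apply: (subsetP XclX); apply: (subsetP (sEB _ (subxx B))).
    rewrite inE eG; apply/subsetP => z ze.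
    have := subsetP eS _ ze; rewrite !inE => /orP[/(subsetP sQ'B)//|/orP[/eqP zv|/eqP->//]].
    by rewrite -zv ze in ve.
  have [w [vw eE]] := edge_at eG ve.
  rewrite eE; apply: vQ'cl.
  have : w \in e by rewrite eE !inE eqxx orbT.
  move=> /(subsetP eS); rewrite !inE => /orP[//|/orP[/eqP wv|/eqP wa]].
    by rewrite wv eqxx in vw.
  by rewrite eE wa eqxx in ne.
apply/subsetP => e; rewrite inE => /andP[eG eS].
have [ve|ve] := boolP (v \in e); last first.
  apply: (subsetP XclX); apply: (subsetP (sEB _ (subxx B))).
  rewrite inE eG; apply/subsetP => z ze.
  by have := subsetP eS _ ze; rewrite !inE => /orP[/eqP zv|//]; rewrite -zv ze in ve.
have [w [vw eE]] := edge_at eG ve.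
rewrite eE; apply: edgeB; last by rewrite -eE.
have : w \in e by rewrite eE !inE eqxx orbT.
by move=> /(subsetP eS); rewrite !inE => /orP[/eqP wv|//]; rewrite wv eqxx in vw.
Qed.

(** Submodularity for [E B] and [E (v |: Q)]: their intersection contains [E Q], and by
    [closure_star] their union spans [E (v |: B)]. *)
Lemma rank_increment_le B Q v :
  A \subset B -> v \notin B -> Q \subset B -> k <= #|Q| -> #|Q| <= N ->
  joined EG Q Q -> joined EG [set v] Q ->
  r (E (v |: B)) + r (E Q) <= r (E B) + r (E (v |: Q)).
Proof.
move=> sAB vB sQB kQ QN jQ jvQ.
have h := closure_star sAB vB sQB kQ QN jQ jvQ.
have {h} h := rank_closure_le mr _ h.
have sX : E B :|: E (v |: Q) \subset EG by rewrite subUset !induced_sub.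
apply: leq_trans (rank_submod mr (induced_sub EG B) (induced_sub EG (v |: Q))).
apply: leq_add; first exact: h.
apply: (rankS mr); last by rewrite subIset ?induced_sub.
by rewrite subsetI !inducedS ?subsetUr.
Qed.

Lemma rank_le_of_increments B f :
  A \subset B -> (forall v, v \notin B -> r (E (v |: B)) <= r (E B) + f) ->
  r EG <= r (E B) + f * n.
Proof.
move=> sAB incr.
(* Attach the vertices of [U] to [B] without the edges inside [U]; edges that miss [B] are recovered
   from the closure at the end. *)
pose X U := E B :|: \bigcup_(v in U) E (v |: B).
have sXG U : X U \subset EG.
  by rewrite subUset induced_sub; apply/bigcupsP => v _; apply: induced_sub.
have rX U : r (X U) <= r (E B) + f * #|U|.
  elim: {U}_.+1 {-2}U (ltnSn #|U|) => // j IH U cU.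
  have [->|[v vU]] := set_0Vmem U; first by rewrite /X big_set0 setU0 cards0 muln0 addn0.
  rewrite (cardsD1 v) vU in cU *.
  have {}IH := IH (U :\ v); have {}IH := IH ltac:(lia).
  have XE : X U = X (U :\ v) :|: E (v |: B).
    by rewrite /X (big_setD1 v) //= setUA [in RHS]setUAC.
  have [vB|vB] := boolP (v \in B).
    rewrite XE (setUidPl _); first by rewrite mulnDr; lia.
    by rewrite (setUidPr _) ?sub1set // subsetUl.
  (* The old set and [E (v |: B)] share at least [E B], so by submodularity [v] adds at most its
     increment over [B]. *)
  have := rank_submod mr (sXG (U :\ v)) (induced_sub EG (v |: B)).
  rewrite -XE => h.
  have : r (E B) <= r (X (U :\ v) :&: E (v |: B)).
    apply: (rankS mr); last by rewrite subIset ?sXG.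
    by rewrite subsetI subsetUl inducedS ?subsetUr.
  have := incr v vB; rewrite mulnDr muln1; lia.
have := rX setT; rewrite cardsT card_ord; apply: leq_trans.
have XclX := sub_closure r (sXG setT).
have inX e v : e \in EG -> e \subset v |: B -> e \in X setT.
  by move=> eG eS; apply/setUP; right; apply/bigcupP; exists v; rewrite ?inE ?eG.
apply: (rank_closure_le mr (sXG setT)); apply/subsetP => e eG.
have := subsetP sG _ eG; rewrite inE => /cards2P[x [y [xy eE]]].
have [xB|xB] := boolP (x \in B).
  apply: (subsetP XclX); apply: (inX _ y) => //.
  by rewrite eE subUset !sub1set !inE xB eqxx orbT.
have [yB|yB] := boolP (y \in B).
  apply: (subsetP XclX); apply: (inX _ x) => //.
  by rewrite eE subUset !sub1set !inE yB eqxx orbT.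
(* An edge [xy] missing [B] is spanned through a clique [Q] of [A] joined to both ends: every other
   edge on [Q], [x], [y] has at most one end outside [B]. *)
have [|Q [sQ cQ dQ jQ jQM]] := @common_clique n EG A m k [set x; y] ext.
  by rewrite cards2 xy; lia.
have sQB := subset_trans sQ sAB.
have nQ z : z \notin B -> z \notin Q by apply: contraNN => /(subsetP sQB).
rewrite eE; apply: (@closure_clique_edge _ _ _ mr _ _ sat _ Q) => //.
- by rewrite cQ.
- exact: nQ.
- exact: nQ.
- apply: joinedUU => //; apply: joinedUU; try exact: joined1.
  by move=> a b; rewrite !inE => /eqP-> /eqP->; rewrite -eE.
apply/subsetP => e'; rewrite inE in_set1 inE => /and3P[ne eG' eS].
apply: (subsetP XclX).
have [xe|xe] := boolP (x \in e').
  apply: (inX _ x) => //; apply/subsetP => z ze.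
  have := subsetP eS _ ze; rewrite !inE => /orP[/(subsetP sQB)->|/orP[->|/eqP zy]] //.
    by rewrite orbT.
  have [w [_ e'E]] := edge_at eG' xe.
  move: ze; rewrite e'E !inE zy eq_sym (negPf xy) /= => /eqP yw.
  by rewrite e'E yw eqxx in ne.
apply: (inX _ y) => //; apply/subsetP => z ze.
have := subsetP eS _ ze; rewrite !inE => /orP[/(subsetP sQB)->|/orP[/eqP zx|->]] //.
  by rewrite orbT.
by rewrite -zx ze in xe.
Qed.

(** The list is in reverse order of addition: its head is the latest vertex, tested against [A] and
    the tail. *)
Fixpoint greedy f (t : seq 'I_n) : Prop :=
  if t is v :: t' then
    [/\ v \notin A :|: [set x in t'],
        r (E (A :|: [set x in t'])) + f < r (E (v |: (A :|: [set x in t']))) &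
        greedy f t']
  else True.

(** Build [S] in order of addition. The increment of [v] over everything present is at least [f.+1]
    and at most its increment over the clique of earlier vertices of [S]. The first [k] vertices are
    not counted, since that comparison needs a clique of size at least [k]. *)
Lemma greedy_clique_rank f t S :
  greedy f t -> S \subset [set x in t] -> #|S| <= N -> joined EG S S ->
  f.+1 * (#|S| - k) <= r (E S).
Proof.
elim: t S => [|v t IH] S /=.
  move=> _ sS _ _; suff -> : S = set0 by rewrite cards0 sub0n muln0.
  by apply/eqP; rewrite -subset0; apply: subset_trans sS _; apply/subsetP => x; rewrite !inE.
set B := A :|: _ => -[vB incr gt] sS cS jS.
have [vS|vS] := boolP (v \in S); last first.
  apply: IH => //; apply/subsetP => x xS.
  have := subsetP sS _ xS; rewrite !inE => /orP[/eqP xv|//].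
  by rewrite -xv xS in vS.
set Q := S :\ v.
have SE : S = v |: Q by rewrite setD1K.
have sQS : Q \subset S by apply: subsetDl.
have sQt : Q \subset [set x in t].
  apply/subsetP => x; rewrite in_setD1 => /andP[xv xS].
  by have := subsetP sS _ xS; rewrite !inE (negPf xv).
have cSE : #|S| = #|Q|.+1 by rewrite (cardsD1 v) vS.
have [kQ|kQ] := leqP k #|Q|; last first.
  have /eqP -> : #|S| - k == 0 by rewrite subn_eq0 cSE.
  by rewrite muln0.
have jQ : joined EG Q Q by apply: joinedS jS.
have jvQ : joined EG [set v] Q by apply: joinedS jS; rewrite ?sub1set.
have QN : #|Q| <= N by apply: leq_trans cS; rewrite cSE.
have h := IH Q gt sQt QN jQ.
have := @rank_increment_le B Q v (subsetUl _ _) vB _ kQ QN jQ jvQ.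
move=> /(_ (subset_trans sQt (subsetUr _ _))); rewrite -SE cSE subSn // mulnS.
move: incr h; move: (r (E (v |: B))) (r (E B)) (r (E Q)) (r (E S)) (f.+1 * _).
by clear; lia.
Qed.

Lemma greedy_step f j :
  (exists2 t, greedy f t & size t = j) \/
  (exists2 B : {set 'I_n}, (A \subset B) && (#|B| <= #|A| + j) &
     forall v, v \notin B -> r (E (v |: B)) <= r (E B) + f).
Proof.
elim: j => [|j [[t gt st]|[B /andP[sB cB] hB]]]; first by left; exists [::].
  have [/existsP[v /andP[vB hv]]|/existsPn h] :=
    boolP [exists v, (v \notin A :|: [set x in t]) &&
      (r (E (A :|: [set x in t])) + f < r (E (v |: (A :|: [set x in t]))))].
    by left; exists (v :: t) => //=; rewrite st.
  right; exists (A :|: [set x in t]).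
    rewrite subsetUl /=; apply: leq_trans (leq_card_setU _ _).1 _.
    rewrite leq_add2l cardsE; apply: leq_trans (card_size t) _; by rewrite st.
  by move=> v vB; have := h v; rewrite vB /= -leqNgt.
right; exists B => //; rewrite sB; lia.
Qed.

(** After [T0] greedy steps an N-clique among the new vertices would have rank at least
    [f.+1 * (N - k)], above its bound [wsat EF (Kn N)]. So the process sticks at a [B] with at most
    [#|A| + T0] vertices, whose edges number at most [#|B| ^ 2]. *)
Lemma rank_le_polylog f T0 :
  (forall T : {set 'I_n}, T0 <= #|T| ->
     exists S, [/\ S \subset T, #|S| = N & joined EG S S]) ->
  wsat EF (Kn N) < f.+1 * (N - k) ->
  r EG <= f * n + (#|A| + T0) ^ 2.
Proof.
move=> cliq wN; have [[t gt st]|[B /andP[sB cB] hB]] := greedy_step f T0.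
  have ut : uniq t.
    elim: t gt {st} => //= v t IH [vB _ /IH ->]; rewrite andbT.
    by move: vB; rewrite !inE negb_or => /andP[].
  have [|S [sS cS jS]] := cliq [set x in t].
    by rewrite cardsE (card_uniqP ut) st.
  have h := greedy_clique_rank gt sS _ jS; rewrite cS in h.
  have := rank_clique_le_wsat mr sat sG jS; rewrite cS => h2.
  by have := leq_trans (leq_trans wN (h (leqnn _))) h2; rewrite ltnn.
have := rank_le_of_increments sB hB.
have := rank_le_card mr (induced_sub EG B).
have := card_induced B sG.
have : #|B| ^ 2 <= (#|A| + T0) ^ 2 by rewrite leq_exp2r.
lia.
Qed.

End RankBound.

(** * Random subsets: union bound and independence *)

Section BernoulliSubset.
Variables (R : realType) (T : finType) (p : R).
Hypothesis p01 : (0 < p < 1)%R.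
Implicit Types (K H : {set T}) (P : pred {set T}).
Local Open Scope ring_scope.

(** The law of [Gnp_prob] over an arbitrary ground set [K], so that the edge set can be split into
    independent parts. *)
Definition bern K P : R :=
  \sum_(H : {set T} | (H \subset K) && P H) p ^+ #|H| * (1 - p) ^+ (#|K| - #|H|).

Let p_ge0 : 0 <= p. Proof. by case/andP: p01 => /ltW. Qed.
Let q_ge0 : 0 <= 1 - p. Proof. by case/andP: p01 => _ /ltW; rewrite subr_ge0. Qed.

Let term_ge0 K H : 0 <= p ^+ #|H| * (1 - p) ^+ (#|K| - #|H|).
Proof. by rewrite mulr_ge0 ?exprn_ge0. Qed.

Lemma bern_ge0 K P : 0 <= bern K P.
Proof. by apply: sumr_ge0. Qed.

Lemma eq_bern K P P' : (forall H, H \subset K -> P H = P' H) -> bern K P = bern K P'.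
Proof.
by move=> PP; apply: eq_bigl => H; case: (boolP (H \subset K)) => // /PP ->.
Qed.

Lemma le_bern K P P' :
  (forall H, H \subset K -> P H -> P' H) -> bern K P <= bern K P'.
Proof.
move=> PP; rewrite /bern [leRHS]big_mkcond [leLHS]big_mkcond; apply: ler_sum => H _.
have [sH|//] := boolP (H \subset K) => /=.
have [/PP -> //|_] := boolP (P H); by case: ifP.
Qed.

Lemma bernT K : bern K predT = 1.
Proof.
(* Expand the product of [p + (1 - p)] over [K]; elements outside [K] get the factor [0 + 1], which
   kills the subsets not contained in [K]. *)
pose F i : R := if i \in K then p else 0; pose G i : R := if i \in K then 1 - p else 1.
have FG : \prod_i (F i + G i) = 1.
  by apply: big1 => i _; rewrite /F /G; case: ifP; rewrite ?add0r // addrC subrK.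
rewrite -[RHS]FG bigA_distr /bern big_mkcond /=; apply: eq_bigr => H _.
rewrite andbT; case: ifPn => sH; last first.
  have /subsetPn[x xH xK] := sH.
  by rewrite (bigD1 x) //= xH /F (negPf xK) mul0r.
rewrite (bigID [in H]) /= -cardsDS //; congr (_ * _); rewrite -prodr_const.
  by apply: eq_bigr => i iH; rewrite iH /F (subsetP sH).
rewrite big_mkcond [RHS]big_mkcond /=; apply: eq_bigr => i _.
by rewrite inE; case: (i \in H); rewrite //= /G; case: (i \in K).
Qed.

Lemma bernC K P : bern K (predC P) = 1 - bern K P.
Proof.
apply/eqP; rewrite eq_sym subr_eq -(bernT K) {1}/bern (bigID P) /= addrC.
by apply/eqP; congr (_ + _); apply: eq_bigl => H; rewrite andbT.
Qed.

Lemma bern_le1 K P : bern K P <= 1.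
Proof. by rewrite -(bernT K); apply: le_bern. Qed.

Lemma bern_full K : bern K (fun H => ~~ (K \subset H)) = 1 - p ^+ #|K|.
Proof.
rewrite -[LHS]/(bern K (predC (fun H : {set T} => K \subset H))) bernC; congr (1 - _).
rewrite /bern (big_pred1 K) ?subnn ?expr0 ?mulr1 // => H.
by rewrite /= eqEsubset.
Qed.

Lemma bern_union (I : finType) (Q : pred I) K (P : I -> pred {set T}) :
  bern K (fun H => [exists i, Q i && P i H]) <= \sum_(i | Q i) bern K (P i).
Proof.
rewrite /bern; under [leRHS]eq_bigr do rewrite big_mkcondr /=.
rewrite exchange_big big_mkcondr /=; apply: ler_sum => H sH.
case: ifP => [/existsP[i /andP[Qi Pi]]|_].
  by rewrite (bigD1 i) //= Pi lerDl sumr_ge0 // => j _; case: ifP.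
by apply: sumr_ge0 => j _; case: ifP.
Qed.

(** [H] corresponds to the pair of its traces on [K1] and [K2], and the weight is multiplicative
    because cardinalities add. *)
Lemma bern_indep K1 K2 P1 P2 : [disjoint K1 & K2] ->
  bern (K1 :|: K2) (fun H => P1 (H :&: K1) && P2 (H :&: K2)) = bern K1 P1 * bern K2 P2.
Proof.
move=> dK; rewrite /bern big_distrlr /= pair_big /=.
have dK0 : K1 :&: K2 = set0 by apply/eqP; rewrite setI_eq0.
rewrite [RHS](reindex_onto (fun H => (H :&: K1, H :&: K2)) (fun q => q.1 :|: q.2)) /=; last first.
  move=> [H1 H2] /= /andP[/andP[s1 _] /andP[s2 _]]; rewrite !setIUl; congr (_, _).
    rewrite (setIidPl s1) (_ : H2 :&: K1 = set0) ?setU0 //.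
    by apply/eqP; rewrite -subset0 -dK0 setIC setIS.
  rewrite (setIidPl s2) (_ : H1 :&: K2 = set0) ?set0U //.
  by apply/eqP; rewrite -subset0 -dK0 setSI.
apply: eq_big => H.
  rewrite !subsetIr /= -setIUr.
  by rewrite andbC; congr (_ && _); apply/setIidPl/eqP.
move=> /andP[sH _].
have cH : #|H| = (#|H :&: K1| + #|H :&: K2|)%N.
  rewrite -{1}(setIidPl sH) setIUr cardsU (_ : (H :&: K1) :&: (H :&: K2) = set0) ?cards0 ?subn0 //.
  by rewrite setIACA setIid dK0 setI0.
have c1 : (#|H :&: K1| <= #|K1|)%N by rewrite subset_leq_card ?subsetIr.
have c2 : (#|H :&: K2| <= #|K2|)%N by rewrite subset_leq_card ?subsetIr.
rewrite cardsU dK0 cards0 subn0 cH mulrACA -!exprD; congr (_ * _ ^+ _).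
by rewrite subnDA -addnBAC // -addnBA.
Qed.

(** Peel off one block [B j]: it is independent of the rest of [K], and it is missed with
    probability [1 - p ^+ #|B j|], at most [1 - p ^+ m]. *)
Lemma bern_blocks (J : finType) (B : J -> {set T}) (D : {set J}) K m :
  {in D, forall j, B j \subset K} -> {in D, forall j, #|B j| <= m}%N ->
  {in D &, forall i j, i != j -> [disjoint B i & B j]} ->
  bern K (fun H => [forall j in D, ~~ (B j \subset H)]) <= (1 - p ^+ m) ^+ #|D|.
Proof.
move=> + cB; elim: {D}_.+1 {-2}D (ltnSn #|D|) K cB => // d IH D cD K cB sB dB.
have [->|[j jD]] := set_0Vmem D; first by rewrite cards0 expr0 bern_le1.
have p_le1 : p <= 1 by case/andP: p01 => _ /ltW.
rewrite (cardsD1 j) jD in cD *.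
have dj i : i \in D :\ j -> [disjoint B j & B i].
  by rewrite in_setD1 => /andP[ij iD]; apply: dB; rewrite // eq_sym.
have -> : bern K (fun H => [forall j in D, ~~ (B j \subset H)]) =
   bern (B j :|: (K :\: B j)) (fun H => ~~ (B j \subset H :&: B j) &&
      [forall i in D :\ j, ~~ (B i \subset H :&: (K :\: B j))]).
  have -> : B j :|: (K :\: B j) = K by rewrite -{1}(setIidPr (sB j jD)) setID.
  apply: eq_bern => H sH.
  have sBi i : i \in D :\ j -> (B i \subset H :&: (K :\: B j)) = (B i \subset H).
    move=> iD; rewrite subsetI subsetD disjoint_sym dj // sB ?andbT //.
    by case/setD1P: iD.
  rewrite subsetI subxx andbT; apply/forall_inP/andP => [h|[hj /forall_inP h] i iD].
    split; first exact: h.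
    apply/forall_inP => i iD; rewrite sBi //; apply: h; by case/setD1P: iD.
  have [->//|ij] := eqVneq i j.
  by rewrite -sBi ?h // !inE ij.
rewrite (@bern_indep (B j) (K :\: B j) (fun H => ~~ (B j \subset H))
  (fun H => [forall i in D :\ j, ~~ (B i \subset H)])); last first.
  rewrite disjoint_sym disjoints_subset; apply/subsetP => x.
  by rewrite !inE => /andP[].
rewrite bern_full exprS ler_pM ?subr_ge0 ?exprn_ile1 ?bern_ge0 //.
  by rewrite lerD2l lerN2 ler_wiXn2l ?cB.
apply: IH => //.
- move=> i /setD1P[_ iD]; exact: cB.
- move=> i iD; rewrite subsetD disjoint_sym dj // sB //; by case/setD1P: iD.
- by move=> i l /setD1P[_ iD] /setD1P[_ lD]; apply: dB.
Qed.

End BernoulliSubset.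

(** * Edgeless F, and the two bad events for the random graph *)

(** A copy of an edgeless graph contains no new edge, so no addition is ever legal. This serves to
    exclude [EF] empty, as the complete graph has quadratically many edges. *)
Lemma wsat_edgeless_ge k n (EG : {set {set 'I_n}}) :
  #|EG| <= wsat (set0 : {set {set 'I_k}}) EG.
Proof.
have [H [[sH [s [_ _ HE sC]]] <-]] := wsat_attained (set0 : {set {set 'I_k}}) EG.
case: s sC HE => [|x s] sC HE.
  by apply/subset_leq_card; rewrite HE; apply/subsetP => e; rewrite !inE orbF.
have [C [[phi [_ [-> _]]]]] := sC 0 isT.
by rewrite /copy_edges imset0 inE.
Qed.

Section BadEvents.
Variable n : nat.
Implicit Types (H : {set {set 'I_n}}) (A M : {set 'I_n}).

Definition star a M : {set {set 'I_n}} := [set [set a; x] | x in M].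

(** Vertex sets of size at most [m] are represented by maps from ['I_m], which gives [n ^ m] terms
    in the union bound; failure at each [a] is a missed block. *)
Definition unextended m A : pred {set {set 'I_n}} := fun H =>
  [exists f : {ffun 'I_m -> 'I_n},
    predT f && [forall a in A :\: f @: setT, ~~ (star a (f @: setT) \subset H)]].

(** The cardinality test selects the injective maps; edges appear as singleton blocks to fit
    [bern_blocks]. *)
Definition has_independent s : pred {set {set 'I_n}} := fun H =>
  [exists f : {ffun 'I_s -> 'I_n}, (#|f @: setT| == s) &&
    [forall e in [set e : {set 'I_n} | (e \subset f @: setT) && (#|e| == 2)],
       ~~ ([set e] \subset H)]].

Lemma set_in_ffun_image m M : 0 < n -> #|M| <= m ->
  exists f : {ffun 'I_m -> 'I_n}, M \subset f @: setT.
Proof.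
case: n M => // n' M _ cM.
(* The default [ord0] pads the list when [M] has fewer than [m] elements, so only an inclusion is
   obtained. *)
exists [ffun i : 'I_m => nth ord0 (enum M) i]; apply/subsetP => x xM.
have xi : index x (enum M) < m.
  by apply: leq_trans cM; rewrite cardE index_mem mem_enum.
by apply/imsetP; exists (Ordinal xi); rewrite // ffunE nth_index ?mem_enum.
Qed.

Lemma extendedP m A H M : 0 < n -> ~~ unextended m A H -> #|M| <= m ->
  exists2 a, a \in A :\: M & joined H [set a] M.
Proof.
move=> n0 /existsPn uH /(set_in_ffun_image n0)[f sM].
have := uH f; rewrite /= => /forall_inPn[a aA]; rewrite negbK => sH.
exists a; first by apply: subsetP aA; apply: setDS.
move=> x y; rewrite inE => /eqP-> yM _; apply: (subsetP sH).
by apply/imsetP; exists y => //; apply: (subsetP sM).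
Qed.

Lemma no_independentP s H (I : {set 'I_n}) : 0 < n -> ~~ has_independent s H ->
  #|I| = s -> exists x y, [/\ x \in I, y \in I, x != y & [set x; y] \in H].
Proof.
move=> n0 /existsPn hH cI; have [|f sI] := @set_in_ffun_image s I n0; first by rewrite cI.
have cf : #|f @: setT| <= s.
  by apply: leq_trans (leq_imset_card _ _) _; rewrite cardsT card_ord.
have IE : I = f @: setT by apply/eqP; rewrite eqEcard sI cI.
have := hH f; rewrite -IE cI eqxx /= => /forall_inPn[e]; rewrite inE negbK sub1set.
move=> /andP[eI /cards2P[x [y [xy eE]]]] eH; exists x, y; split=> //; last by rewrite -eE.
  by apply: (subsetP eI); rewrite eE !inE eqxx.
by apply: (subsetP eI); rewrite eE !inE eqxx orbT.
Qed.

(** The deterministic conclusion off the bad events: common neighbours for sets of size [N + k + 1],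
    and the Ramsey threshold [s ^ N] as number of greedy steps. *)
Lemma rksat_le k (EF : {set {set 'I_k}}) N f s A H :
  is_graph EF -> EF != set0 -> 0 < n -> H \subset Kn n ->
  wsat EF (Kn N) < f.+1 * (N - k) ->
  ~~ unextended (N + k + 1) A H -> ~~ has_independent s H ->
  rksat EF H <= f * n + (#|A| + s ^ N) ^ 2.
Proof.
move=> gF EF0 n0 sH wN uH iH; apply/bigmax_leqP => j /asboolP[r [mr sat <-]].
apply: (rank_le_polylog gF EF0 sH mr sat _ (leqnn _) _ wN).
  by move=> M; apply: extendedP.
move=> T; apply: clique_in_large_set => I; exact: no_independentP.
Qed.

Section Probability.
Variables (R : realType) (p : R).
Hypothesis p01 : (0 < p < 1)%R.
Local Open Scope ring_scope.

Lemma star_inj a a' M x : a \notin M -> x \in star a M -> x \in star a' M -> a = a'.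
Proof.
move=> aM /imsetP[y yM ->] /imsetP[z zM] /setP/(_ a).
rewrite !inE eqxx /= => /esym/orP[/eqP //|/eqP az].
by rewrite az zM in aM.
Qed.

Let q01 m : 0 <= 1 - p ^+ m <= 1.
Proof.
case/andP: p01 => p0 p1; have := ltW p0 => p0'; have := ltW p1 => p1'.
by rewrite subr_ge0 exprn_ile1 //= gerBl exprn_ge0.
Qed.

(** For a fixed image [M], stars centred at distinct vertices outside [M] are disjoint blocks of at
    most [m] edges, and [A] offers at least [#|A| - m] centres. *)
Lemma prob_unextended m A :
  bern p (Kn n) (unextended m A) <= n%:R ^+ m * (1 - p ^+ m) ^+ (#|A| - m).
Proof.
apply: le_trans (bern_union p01 _ _ _) _.
have -> : n%:R ^+ m * (1 - p ^+ m) ^+ (#|A| - m) =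
    \sum_(f : {ffun 'I_m -> 'I_n} | predT f) (1 - p ^+ m) ^+ (#|A| - m).
  by rewrite sumr_const card_ffun !card_ord -[RHS]mulr_natl natrX.
apply: ler_sum => f _; set M := f @: setT.
have cM : (#|M| <= m)%N.
  by apply: leq_trans (leq_imset_card _ _) _; rewrite cardsT card_ord.
apply: le_trans (@bern_blocks R _ p p01 _ (star^~ M) (A :\: M) (Kn n) m _ _ _) _.
- move=> a; rewrite inE => /andP[aM _]; apply/subsetP => _ /imsetP[x xM ->].
  by rewrite inE cards2; have -> // : a != x by apply: contraNneq aM => ->.
- by move=> a _; apply: leq_trans (leq_imset_card _ _) cM.
- move=> a a'; rewrite inE => /andP[aM _] _ aa'.
  rewrite -setI_eq0; apply/eqP/setP => x; rewrite !inE; apply/negP => /andP[xa xa'].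
  by case/eqP: aa'; apply: star_inj xa xa'.
case/andP: (q01 m) => q0 q1; apply: ler_wiXn2l => //.
rewrite leq_subLR -(cardsID M A) leq_add2r; apply: leq_trans cM.
by apply: subset_leq_card; apply: subsetIr.
Qed.

Lemma prob_has_independent s :
  bern p (Kn n) (has_independent s) <= n%:R ^+ s * (1 - p) ^+ 'C(s, 2).
Proof.
apply: le_trans (bern_union p01 _ _ _) _.
have -> : n%:R ^+ s * (1 - p) ^+ 'C(s, 2) =
    \sum_(f : {ffun 'I_s -> 'I_n}) (1 - p) ^+ 'C(s, 2).
  by rewrite sumr_const card_ffun !card_ord -[RHS]mulr_natl natrX.
rewrite big_mkcond; apply: ler_sum => f _; case: ifP => [/eqP cf|_]; last first.
  by have /andP[q0 _] := q01 1; rewrite exprn_ge0 // -(expr1 p).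
set D := [set e : {set 'I_n} | (e \subset f @: setT) && (#|e| == 2)].
have <- : #|D| = 'C(s, 2) by rewrite cards_draws cf.
rewrite -[p in leRHS]expr1.
apply: (@bern_blocks R _ p p01 _ (fun e => [set e]) D (Kn n) 1).
- by move=> e; rewrite inE sub1set inE => /andP[].
- by move=> e _; rewrite cards1.
- by move=> e e' _ _ ee'; rewrite disjoints1 inE.
Qed.

Lemma prob_rksat_ge k (EF : {set {set 'I_k}}) N f s m A (P : pred {set {set 'I_n}}) :
  m = (N + k + 1)%N ->
  is_graph EF -> EF != set0 -> (0 < n)%N ->
  (wsat EF (Kn N) < f.+1 * (N - k))%N ->
  (forall H, (rksat EF H <= f * n + (#|A| + s ^ N) ^ 2)%N -> P H) ->
  1 - (n%:R ^+ m * (1 - p ^+ m) ^+ (#|A| - m) + n%:R ^+ s * (1 - p) ^+ 'C(s, 2))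
    <= Gnp_prob p P.
Proof.
move=> mE gF EF0 n0 wN hP; rewrite -[Gnp_prob p P]/(bern p (Kn n) P).
rewrite lerBlDr addrC -lerBlDr -bernC //.
apply: (@le_trans _ _ (bern p (Kn n) (unextended m A) + bern p (Kn n) (has_independent s)));
  last by apply: lerD; [apply: prob_unextended | apply: prob_has_independent].
(* The union of the two bad events, indexed by booleans. *)
pose E b := if b then unextended m A else has_independent s.
apply: le_trans (le_trans (bern_union p01 predT (Kn n) E) _); last first.
  by rewrite big_bool.
apply: le_bern => // H sH /= nP; apply/existsP.
have [uH|uH] := boolP (unextended m A H); first by exists true.
exists false; apply: contraNT nP => iH; apply: hP.
by rewrite mE in uH; exact: rksat_le uH iH.
Qed.

End Probability.
End BadEvents.

(** * Asymptotic estimates *)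

Lemma sqr_le_exp2 l : 4 <= l -> l ^ 2 <= 2 ^ l.
Proof.
elim: l => // l IH; rewrite leq_eqVlt => /orP[/eqP<-//|l4].
have := IH l4; rewrite [2 ^ l.+1]expnS -!mulnn; nia.
Qed.

(** The exponent condition of [union_bound_term] for the unextended event, with [a = m] and
    [l ^ 2 - m] trials. *)
Lemma linear_exponent_le_sqr K m l : K * (2 * m + 1) + m < l -> K * (l.+1 * m + l) <= l ^ 2 - m.
Proof.
move=> hl; rewrite -mulnn.
have h1 : K * (l.+1 * m + l) <= (K * (2 * m + 1)) * l.
  rewrite -[leqRHS]mulnA leq_mul2l; apply/orP; right; nia.
have : (K * (2 * m + 1) + m) * l <= l * l by rewrite leq_mul2r ltnW ?orbT.
rewrite mulnDl; nia.
Qed.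

(** The same condition for independent sets of size [l ^ 2]: a cubic demand against a number of
    pairs of order [l ^ 4]. *)
Lemma cubic_exponent_le_bin K l : 6 * K + 1 < l -> K * (l.+1 * l ^ 2 + l) <= 'C(l ^ 2, 2).
Proof.
case: l => // l hl; rewrite bin2 geq_half_double -muln2.
have a : l.+2 * l.+1 ^ 2 + l.+1 <= 3 * l.+1 ^ 3 by rewrite !expnS expn0; nia.
apply: (@leq_trans (6 * K * l.+1 ^ 3)).
  by move: (l.+2 * _ + _) (l.+1 ^ 3) a; clear; nia.
apply: (@leq_trans (l * l.+1 ^ 3)); first by rewrite leq_mul2r; lia.
by rewrite expnS mulnA mulnC leq_mul2l -mulnn; lia.
Qed.

Section Asymptotics.
Variable R : realType.
Local Open Scope classical_set_scope.
Local Open Scope ring_scope.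

Lemma exists_wsat_small k (EF : {set {set 'I_k}}) (c : R) f X :
  c < f.+1%:R -> (wsat EF (Kn n))%:R / n%:R @[n --> \oo] --> c ->
  exists N, (X < N)%N /\ (wsat EF (Kn N) < f.+1 * (N - k))%N.
Proof.
(* Half of the gap: [f.+1] equals [c + 2d]. One [d] absorbs the error in the limit, and [d * N]
   exceeds the lost term [f.+1 * k]. *)
move=> cf cvg; pose d : R := (f.+1%:R - c) / 2.
have d0 : 0 < d by rewrite divr_gt0 // subr_gt0.
have cd : c < c + d by rewrite ltrDl.
have h1 := cvgr_lt _ cvg _ cd.
have h2 := @nbhs_infty_gtr R (f.+1%:R * k%:R / d).
have h3 := nbhs_infty_gt (maxn X k).
have [N _ hN] : \forall n \near \oo, [/\ (wsat EF (Kn n))%:R / n%:R < c + d,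
   f.+1%:R * k%:R / d < n%:R & (maxn X k < n)%N].
  by near=> n; split; near: n; [exact: h1 | exact: h2 | exact: h3].
have [a b e] := hN N (leqnn _); exists N; move: e; rewrite gtn_max => /andP[XN kN].
split=> //.
have N0 : (0 : R) < N%:R by rewrite ltr0n (leq_ltn_trans _ kN).
rewrite ltr_pdivrMr // in a; rewrite ltr_pdivrMr // in b.
rewrite -(ltr_nat R) natrM natrB 1?ltnW // mulrBr.
apply: (lt_trans a); rewrite ltrBrDr.
have fE : (f.+1%:R : R) = c + d + d by rewrite /d; lra.
have -> : (f.+1%:R : R) * N%:R = (c + d) * N%:R + N%:R * d by rewrite {1}fE; lra.
by rewrite ltrD2l.
Unshelve. all: by end_near. Qed.

Lemma exists_pow_le_half (q : R) : 0 <= q < 1 -> exists K, q ^+ K <= 2^-1.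
Proof.
move=> /andP[q0 q1].
have /cvgr_lt/(_ 2^-1) : (GRing.exp q : R ^nat) @ \oo --> 0 by apply: cvg_expr; rewrite ger0_norm.
by case=> [|K _ /(_ K (leqnn _)) /ltW]; [rewrite invr_gt0 | exists K].
Qed.

(** The count is at most [2 ^ (l.+1 * a)], which half-powers of [q ^+ K] cancel; the remaining
    factor [2 ^ - l] is at most [2 / n.+1] because [n.+1 <= 2 ^ l.+1]. *)
Lemma union_bound_term (q : R) K l n a t :
  0 <= q < 1 -> q ^+ K <= 2^-1 -> (n < 2 ^ l.+1)%N ->
  (K * (l.+1 * a + l) <= t)%N -> n%:R ^+ a * q ^+ t <= 2 / n.+1%:R.
Proof.
move=> /andP[q0 q1] qK nl ht.
have h1 : n%:R ^+ a <= (2 : R) ^+ (l.+1 * a).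
  by rewrite exprM lerXn2r ?nnegrE ?exprn_ge0 // -natrX ler_nat ltnW.
have h2 : q ^+ t <= 2^-1 ^+ (l.+1 * a + l).
  apply: (@le_trans _ _ (q ^+ (K * (l.+1 * a + l)))).
    by apply: ler_wiXn2l => //; apply: ltW.
  by rewrite exprM lerXn2r ?nnegrE ?exprn_ge0 // invr_ge0.
apply: le_trans (ler_pM _ _ h1 h2) _; rewrite ?exprn_ge0 //.
rewrite exprD mulrA -exprMn divff ?pnatr_eq0 // expr1n mul1r exprVn.
rewrite ler_pdivlMr ?ltr0n // mulrC ler_pdivrMr ?exprn_gt0 //.
by rewrite -exprS -natrX ler_nat.
Qed.

Lemma trunc_log_le_ln n : (0 < n)%N -> (trunc_log 2 n)%:R <= 2 * ln (n%:R : R).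
Proof.
move=> n0; set l := trunc_log 2 n.
have h : (2 : R) ^+ l <= n%:R by rewrite -natrX ler_nat trunc_logP.
have h2 : ln ((2 : R) ^+ l) <= ln n%:R by rewrite ler_ln ?posrE ?exprn_gt0 ?ltr0n.
rewrite lnXn // in h2.
(* From [ln (1 + x) <= x] at [x = - 1/2]. *)
have ln2 : 2^-1 <= ln (2 : R).
  have := @le_ln1Dx R (- 2^-1); rewrite (_ : 1 + - 2^-1 = 2^-1); last by lra.
  rewrite lnV ?posrE // => h3; have : - ln (2 : R) <= - 2^-1 by apply: h3; lra.
  by rewrite lerN2.
have : 2^-1 *+ l <= ln (2 : R) *+ l by rewrite lerMn2r ln2 orbT.
move=> /le_trans/(_ h2); rewrite -[_ *+ l]mulr_natr; lra.
Qed.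

Lemma floor_nat (c : R) : 0 <= c -> exists2 f : nat, Num.floor c = f%:Z & c < f.+1%:R.
Proof.
rewrite -floor_ge0; case: (Num.floor c) (floorD1_gt c) => [f|f] //= h _.
by exists f => //; rewrite -addn1 natrD; rewrite intrD in h.
Qed.

Lemma polylog_bound n N l : (0 < N)%N -> (4 <= l)%N -> l%:R <= 2 * ln (n%:R : R) ->
  ((l ^ 2 + (l ^ 2) ^ N) ^ 2)%:R <= ln (n%:R : R) ^+ (8 * N + 4).
Proof.
move=> N0 l4 lln; set x := ln _ in lln *.
have l4R : (4%:R : R) <= l%:R by rewrite ler_nat.
have x2 : 2 <= x by lra.
(* The sum is at most twice [l ^ (2 * N)], and the resulting factor 4 is at most [l ^ 2]. Then
   [l <= 2 * x <= x ^+ 2] doubles the exponent. *)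
apply: (@le_trans _ _ ((l ^ (4 * N + 2))%:R)).
  rewrite ler_nat -expnM.
  have h : (l ^ 2 <= l ^ (2 * N))%N by rewrite leq_exp2l; lia.
  have h2 : (l ^ (4 * N + 2) = l ^ 2 * (l ^ (2 * N) * l ^ (2 * N)))%N.
    by rewrite -!expnD; congr expn; lia.
  rewrite h2; have h4 : (4 <= l ^ 2)%N by rewrite -mulnn; nia.
  by move: (l ^ 2)%N (l ^ (2 * N))%N h h4; clear; move=> a b h h4; rewrite -mulnn; nia.
rewrite (_ : 8 * N + 4 = 2 * (4 * N + 2))%N; last by lia.
rewrite natrX exprM lerXn2r ?nnegrE ?exprn_ge0 //; first by lra.
by rewrite expr2; nra.
Qed.

End Asymptotics.

(** * Choice of parameters and conclusion *)

Local Open Scope classical_set_scope.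
Local Open Scope ring_scope.

Theorem theorem4 (R : realType) (p : R) (k : nat) (EF : {set {set 'I_k}}) (c : R) :
  0 < p < 1 -> is_graph EF -> 0 <= c ->
  ((wsat EF (Kn n))%:R / n%:R) @[n --> \oo] --> c ->
  exists D : nat,
    (Gnp_prob p (fun H : {set {set 'I_n}} =>
        (rksat EF H)%:R <= (Num.floor c)%:~R * n%:R + (ln (n%:R : R)) ^+ D))
      @[n --> \oo] --> (1 : R).
Proof.
move=> p01 gF c0 cvg.
have [f -> cf] := floor_nat c0.
(* [N > 2 * f + 3] makes ['C(N, 2)] at least [f.+1 * N], which refutes an edgeless F. *)
have [N [NX wN]] := exists_wsat_small (2 * f + 3) cf cvg.
have EF0 : EF != finset.set0.
  apply/eqP => E0; have := wsat_edgeless_ge k (Kn N); rewrite -E0 card_draws card_ord bin2.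
  move=> /leq_ltn_trans/(_ wN); rewrite ltnNge; apply/negP/negPn.
  by rewrite geq_half_double -muln2; nia.
pose m := (N + k + 1)%N.
have [p0 p1] := andP p01.
have q01 : 0 <= 1 - p ^+ m < 1.
  by rewrite subr_ge0 exprn_ile1 ?(ltW p0) ?(ltW p1) //= gtrBl exprn_gt0.
have [K qK] := exists_pow_le_half q01.
(* Dominates the thresholds of both exponent lemmas and the bound [4 <= l]. *)
pose l0 := (K * (2 * m + 1) + m + 6 * K + 4)%N.
exists (8 * N + 4)%N.
(* [harmonic n] is [1 / n.+1]; each bad event will cost at most [2 / n.+1]. *)
apply: (@squeeze_cvgr _ _ _ _ (fun n => 1 - 4 * harmonic n) (fun=> 1)); last 2 first.
- rewrite -[X in _ --> X]subr0 -[X in _ - X](mulr0 4).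
  by apply: cvgB; [exact: cvg_cst | apply: cvgMr; exact: cvg_harmonic].
- exact: cvg_cst.
near=> n.
have n_ge : (2 ^ l0 <= n)%N by near: n; exact: nbhs_infty_ge.
have n0 : (0 < n)%N by apply: leq_trans n_ge; rewrite expn_gt0.
set l := trunc_log 2 n.
have l_ge : (l0 <= l)%N by apply: trunc_log_max.
have [nl1 nl2] := andP (trunc_log_bounds (isT : 1 < 2)%N n0).
have l4 : (4 <= l)%N by apply: leq_trans l_ge; rewrite /l0 leq_addl.
(* Any fixed set of [l ^ 2] vertices would do; an initial segment is taken. *)
pose A : {set 'I_n} := [set i : 'I_n | (i < l ^ 2)%N]%SET.
have cA : #|A| = (l ^ 2)%N.
  have ln : (l ^ 2 <= n)%N by apply: leq_trans nl1; apply: sqr_le_exp2.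
  have -> : A = [set widen_ord ln j | j in 'I_(l ^ 2)]%SET.
    apply/setP => i; rewrite inE; apply/idP/imsetP => [il|[j _ ->]] //=.
    by exists (Ordinal il) => //; apply: val_inj.
  rewrite card_imset ?card_ord // => a b /(congr1 val) /= ab; exact: val_inj.
apply/andP; split; last exact: (bern_le1 p01).
have hP (H : {set {set 'I_n}}) : (rksat EF H <= f * n + (#|A| + (l ^ 2) ^ N) ^ 2)%N ->
    (rksat EF H)%:R <= f%:~R * n%:R + ln (n%:R : R) ^+ (8 * N + 4).
  rewrite -(ler_nat R) natrD natrM cA => /le_trans; apply; rewrite lerD2l.
  by apply: polylog_bound => //; [lia | exact: trunc_log_le_ln].
apply: le_trans (prob_rksat_ge p01 (erefl m) gF EF0 n0 wN hP).
rewrite lerD2l lerN2 (_ : 4 * harmonic n = 2 / n.+1%:R + 2 / n.+1%:R); last first.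
  by rewrite -mulrDl; congr (_ * _); lra.
apply: lerD.
  apply: (union_bound_term q01 qK nl2); rewrite cA; apply: linear_exponent_le_sqr.
  by apply: leq_trans l_ge; rewrite /l0; lia.
(* Since [1 - p <= 1 - p ^+ m], the same base and the same [K] serve for the second event. *)
apply: (@le_trans _ _ (n%:R ^+ (l ^ 2) * (1 - p ^+ m) ^+ 'C(l ^ 2, 2))).
  rewrite ler_wpM2l ?exprn_ge0 // lerXn2r ?nnegrE ?subr_ge0 ?(ltW p1) //.
    by have /andP[] := q01; rewrite subr_ge0.
  rewrite lerD2l lerN2 /m addn1 exprS ler_piMr ?(ltW p0) //.
  by rewrite exprn_ile1 ?(ltW p0) ?(ltW p1).
apply: (union_bound_term q01 qK nl2); apply: cubic_exponent_le_bin.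
by apply: leq_trans l_ge; rewrite /l0; lia.
Unshelve. all: by end_near. Qed.
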